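(* Let $G$ be a finitely generated group. Then $G_{bound}$ is a characteristic subgroup of $G$.
   Context: For a finitely generated group $G$, a finite generating set $S$ of $G$ and $g\in G$, the word-length $l_S(g)$ is the minimal integer $n\ge 0$ such that $g$ is a product of $n$ elements of $S\cup S^{-1}$. $G_{bound}$ denotes the set of all $g\in G$ for which there exists a constant $M>0$ such that $l_S(g)<M$ for every finite generating set $S$ of $G$. A subgroup $H$ of $G$ is characteristic if $\phi(H)=H$ for every automorphism $\phi$ of $G$. *)

(* Defs.v *)
From mathcomp Require Import all_boot all_classical.

Set Implicit Arguments.
Unset Strict Implicit.
Unset Printing Implicit Defensive.

Local Open Scope group_scope.
Local Open Scope classical_set_scope.

Section GroupSets.
Variable G : groupType.
Implicit Types (S H : set G) (g : G) (n : nat).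

Definition is_subgroup H : Prop := group_closed [in H].

Definition generated_subgroup S : set G := smallest is_subgroup S.

Definition finite_generating_set S : Prop :=
  finite_set S /\ generated_subgroup S = [set: G].

Definition is_word_product S g n : Prop :=
  exists w : n.-tuple G,
    [set` w] `<=` S `|` [set s^-1 | s in S] /\ \prod_(x <- w) x = g.

(* The value 0 in the second branch is junk: it is only reached when g is not
   a product of elements of S and their inverses, hence never when S generates
   the group. *)
Definition word_length S g : nat :=
  match pselect (exists n, `[< is_word_product S g n >]) with
  | left ex => ex_minn ex
  | right _ => 0
  end.

(* phi ranges over the bijective endomorphisms; a multiplicative map between
   groups automatically preserves 1 and inverses. *)
Definition is_characteristic_subgroup H : Prop :=
  is_subgroup H /\
  forall phi : {multiplicative G -> G}, bijective phi -> phi @` H = H.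

End GroupSets.

Definition finitely_generated (G : groupType) : Prop :=
  exists S : set G, finite_generating_set S.

Definition G_bound (G : groupType) : set G :=
  [set g | exists M : nat, (0 < M)%N /\
    forall S : set G, finite_generating_set S -> (word_length S g < M)%N].

Arguments G_bound : clear implicits.

(* Main.v *)
Require Import Defs.
From mathcomp Require Import all_boot all_classical.

(** Word length for a fixed generating set [S] satisfies [l 1 = 0] and
    [l (x / y) <= l x + l y] ([word_length_div]), so uniform bounds for [x] and
    [y] add up to a uniform bound for [x / y], and [G_bound G] is a subgroup.

    An automorphism [phi] with inverse [psi] carries words over [T] to words
    over [phi @` T].  Taking [T := psi @` S], which is again a finite generating
    set, gives [l_S (phi g) <= l_(psi S) g] ([word_length_image]).  A bound for
    [g] that is uniform in the generating set therefore bounds [phi g] as well: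
    the automorphism only permutes the generating sets over which the bound is
    taken.  Applied to both [phi] and [psi], this turns the inclusion
    [phi @` G_bound G `<=` G_bound G] into an equality. *)

Set Implicit Arguments.
Unset Strict Implicit.
Unset Printing Implicit Defensive.

Local Open Scope group_scope.
Local Open Scope classical_set_scope.

Section Words.
Variables (G : groupType) (S : set G).

Lemma is_word_productP g n :
  is_word_product S g n <->
  exists w : seq G, [/\ size w = n,
    [set` w] `<=` S `|` [set s^-1 | s in S] & \prod_(x <- w) x = g].
Proof.
split=> [[w [wS wg]]|[w [<- wS wg]]]; first by exists w; rewrite size_tuple.
by exists (in_tuple w).
Qed.

Lemma is_word_product_one : is_word_product S 1 0.
Proof. by apply/is_word_productP; exists [::]; rewrite big_nil. Qed.

Lemma is_word_product_gen s : S s -> is_word_product S s 1.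
Proof.
move=> Ss; apply/is_word_productP; exists [:: s].
split=> //; last by rewrite big_seq1.
by move=> x /=; rewrite inE => /eqP ->; left.
Qed.

(** A word for [g / h] is the word for [g] followed by the reversed word for
    [h] with its letters inverted; these stay in the alphabet because it is
    closed under inversion. *)
Lemma is_word_product_div g h m n :
  is_word_product S g m -> is_word_product S h n ->
  is_word_product S (g / h) (m + n).
Proof.
move=> /is_word_productP[v [<- vS <-]] /is_word_productP[w [<- wS <-]].
apply/is_word_productP; exists (v ++ [seq x^-1 | x <- rev w]); split.
- by rewrite size_cat size_map size_rev.
- move=> x /=; rewrite mem_cat => /orP[/vS //|/mapP[y]].
  rewrite mem_rev => /wS [Sy|[s Ss <-]] ->; first by right; exists y.
  by rewrite invgK; left.
- by rewrite big_cat big_map /= prodgV revK.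
Qed.

Lemma generated_word_product g :
  generated_subgroup S g -> exists n, is_word_product S g n.
Proof.
move=> gS; suff subW : generated_subgroup S `<=`
    [set h | exists n, is_word_product S h n] by exact: subW.
apply: smallest_sub => [|s Ss]; last by exists 1%N; exact: is_word_product_gen.
split; first by rewrite inE; exists 0%N; exact: is_word_product_one.
move=> x y; rewrite !inE => -[m xm] [n yn].
by exists (m + n)%N; exact: is_word_product_div.
Qed.

Lemma word_length_le g n : is_word_product S g n -> (word_length S g <= n)%N.
Proof.
move=> gn; rewrite /word_length; case: pselect => // ex.
by case: ex_minnP => m _; apply; apply/asboolP.
Qed.

(** Every element has a word because [S] generates, which rules out the
    default branch of [word_length]. *)
Lemma word_length_attained g :
  finite_generating_set S -> is_word_product S g (word_length S g).
Proof.
move=> [_ SG]; rewrite /word_length; case: pselect => [ex|nex].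
  by case: ex_minnP => m /asboolP.
have [|n gn] := @generated_word_product g; first by rewrite SG.
by case: nex; exists n; apply/asboolP.
Qed.

Lemma word_length_div g h : finite_generating_set S ->
  (word_length S (g / h) <= word_length S g + word_length S h)%N.
Proof.
move=> Sgen; apply: word_length_le.
by apply: is_word_product_div; exact: word_length_attained.
Qed.

End Words.

Section Images.
Variables (G H : groupType) (f : G -> H).
Hypothesis fM : {morph f : x y / x * y}.

Let f1 : f 1 = 1.
Proof. by apply: (mulgI (f 1)); rewrite -fM !mulg1. Qed.

Let fV : {morph f : x / x^-1}.
Proof. by move=> x; apply: (mulgI (f x)); rewrite -fM !mulgV f1. Qed.

Lemma is_word_product_image (S : set G) g n :
  is_word_product S g n -> is_word_product (f @` S) (f g) n.
Proof.
move=> /is_word_productP[w [<- wS <-]].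
apply/is_word_productP; exists (map f w); split; first by rewrite size_map.
- move=> y /= /mapP[x /wS [Sx|[s Ss <-]] ->]; first by left; exists x.
  by right; exists (f s); [exists s|rewrite fV].
- by rewrite big_map (big_morph f fM f1).
Qed.

Lemma word_length_image (S : set G) g : finite_generating_set S ->
  (word_length (f @` S) (f g) <= word_length S g)%N.
Proof.
move=> Sgen; apply/word_length_le/is_word_product_image.
exact: word_length_attained.
Qed.

(** The preimage of a subgroup containing [f @` S] is a subgroup containing
    [S], hence is all of [G]; surjectivity then fills the target. *)
Lemma finite_generating_set_image (S : set G) : (forall y, exists x, f x = y) ->
  finite_generating_set S -> finite_generating_set (f @` S).
Proof.
move=> fsurj [Sfin SG]; split; first exact: finite_image.
apply/seteqP; split=> // y _ K [[K1 Kdiv] SK].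
have [x <-] := fsurj y.
have xS : generated_subgroup S x by rewrite SG.
apply: (xS (f @^-1` K)); split; last by move=> s Ss; apply: SK; exists s.
split; first by rewrite !inE /= f1 in K1 *.
move=> u v; rewrite !inE /= fM fV => Ku Kv.
by have := Kdiv (f u) (f v); rewrite !inE; exact.
Qed.

End Images.

Lemma G_bound_subgroup (G : groupType) : is_subgroup (G_bound G).
Proof.
split.
  rewrite inE; exists 1%N; split=> // S _.
  by rewrite ltnS; exact/word_length_le/is_word_product_one.
move=> x y; rewrite !inE => -[m [m0 xm]] [n [n0 yn]].
exists (m + n)%N; split; first by rewrite addn_gt0 m0.
move=> S Sgen; apply: (leq_ltn_trans (word_length_div x y Sgen)).
by rewrite -addnS leq_add ?yn// ltnW ?xm.
Qed.

Lemma G_bound_automorphism (G : groupType) (phi psi : G -> G) g :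
  {morph phi : x y / x * y} -> cancel phi psi -> cancel psi phi ->
  G_bound G g -> G_bound G (phi g).
Proof.
move=> phiM phiK psiK [m [m0 gm]]; exists m; split=> // S Sgen.
have psiM : {morph psi : x y / x * y}.
  by move=> x y; apply: (canLR phiK); rewrite phiM !psiK.
have psiSgen : finite_generating_set (psi @` S).
  by apply: finite_generating_set_image => // y; exists (phi y).
have <- : phi @` (psi @` S) = S.
  by rewrite image_comp -[RHS]image_id; apply: eq_imagel => x _ /=.
exact: leq_ltn_trans (word_length_image phiM g psiSgen) (gm _ psiSgen).
Qed.

Theorem lemma2p1 (G : groupType) :
  finitely_generated G -> is_characteristic_subgroup (G_bound G).
Proof.
move=> _; split=> [|phi [psi phiK psiK]]; first exact: G_bound_subgroup.
have phiM : {morph phi : x y / x * y} by exact: gmulfM.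
have psiM : {morph psi : x y / x * y} by exact: can2_gmulfM.
apply/seteqP; split=> [_ [g gB <-]|g gB].
  exact: G_bound_automorphism phiM phiK psiK gB.
by exists (psi g); [exact: G_bound_automorphism psiM psiK phiK gB|exact: psiK].
Qed.
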